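(* On the $3$-dimensional nearest-neighbour qubit lattice $\{0,\dots,L-1\}^3$ ($N=L^3$), for any two dimensional hierarchies $\sigma,\sigma'$ of the three dimensions there is a circuit of $\mathcal O(N)$ nearest-neighbour CNOT/CZ gates and single-qubit Clifford gates, of depth $\mathcal O(L)=\mathcal O(N^{1/3})$, that maps the JW encoding with ordering $m_S^{\sigma}$ to the JW encoding with ordering $m_S^{\sigma'}$.
   Context: Qubits are indexed by $v=(v_1,\dots,v_d)\in\{0,\dots,L-1\}^d$ (here $d=3$), two-qubit gates only between sites at $\ell_1$-distance 1; mode $j$ is identified with qubit $j$. For $s,t\in\{0,\dots,L-1\}$-valued integers, $\rho_s(t)=t$ if $s$ is even and $\rho_s(t)=L-1-t$ if $s$ is odd. A dimensional hierarchy is a permutation $\sigma=(\sigma_1,\dots,\sigma_d)$ of $\{1,\dots,d\}$ ($\sigma_1$ lowest, $\sigma_d$ highest). The $d$-dimensional snake (S-pattern) ordering is $m_S^\sigma(v)=\sum_{i=1}^{d}L^{i-1}\rho_{s_i}(v_{\sigma_i})$ with $s_i=\sum_{k=i+1}^{d}v_{\sigma_k}$ (empty sum $=0$). The JW encoding with ordering $m$ has Majoranas $\chi^{(m)}_{2j}=X_j\prod_{k:m(k)<m(j)}Z_k$, $\chi^{(m)}_{2j+1}=Y_j\prod_{k:m(k)<m(j)}Z_k$; a unitary $W$ maps the encoding with ordering $m$ to that with $m'$ if $W\chi^{(m)}_aW^\dagger=\chi^{(m')}_a$ for all $a$. *)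

(* Defs.v *)
(* Quantum operators are complex matrices over algC. *)
From mathcomp Require Import all_boot all_order all_algebra all_fingroup all_field.
Set Implicit Arguments. Unset Strict Implicit. Unset Printing Implicit Defensive.
Import Order.TTheory GRing.Theory Num.Theory.
Local Open Scope ring_scope.

(* ---------- lattice of qubits {0..L-1}^3 ---------- *)
(* a site v = (v_1,v_2,v_3) is a function 'I_3 -> 'I_L (coordinate i+1 is v i) *)
Definition site (L : nat) := {ffun 'I_3 -> 'I_L}.

(* l1-distance *)
Definition l1dist L (v w : site L) : nat :=
  (\sum_(i < 3) ((v i - w i) + (w i - v i)))%N.

Definition adjacent L (v w : site L) : bool := l1dist v w == 1%N.

(* ---------- snake ordering ---------- *)
Definition rho (L s t : nat) : nat := if odd s then (L - 1 - t)%N else t.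

(* sigma : 'S_3, sigma_{i+1} = sigma i (0-indexed); lowest dimension first *)
Definition snake L (sg : 'S_3) (v : site L) : nat :=
  (\sum_(i < 3)
     L ^ i * rho L (\sum_(k < 3 | (i < k)%N) v (sg k)) (v (sg i)))%N.

(* ---------- Hilbert space of the L^3 qubits ---------- *)
Definition basis L := {ffun site L -> bool}.
Definition dim L := #|basis L|.
Notation op L := ('M[algC]_(dim L)).

(* matrix with entries given on computational-basis states (row = output) *)
Definition opmx L (f : basis L -> basis L -> algC) : op L :=
  \matrix_(r, c) f (enum_val r) (enum_val c).

Definition adj m (A : 'M[algC]_m) : 'M[algC]_m := map_mx (fun z : algC => z^*) A^T.

Definition b2o (b : bool) : 'I_2 := inord (nat_of_bool b).

(* single-qubit Paulis *)
Definition pX : 'M[algC]_2 := \matrix_(i, j) (if i != j then 1 else 0).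
Definition pZ : 'M[algC]_2 :=
  \matrix_(i, j) (if i == j then (if val i == 0%N then 1 else -1) else 0).
Definition pY : 'M[algC]_2 :=
  \matrix_(i, j) (if i == j then 0 else if val i == 0%N then - 'i else 'i).

(* the single-qubit operator u acting on qubit q (identity elsewhere) *)
Definition on1 L (q : site L) (u : 'M[algC]_2) : op L :=
  opmx (fun x y => if [forall k, (k != q) ==> (x k == y k)]
                   then u (b2o (x q)) (b2o (y q)) else 0).

Definition Xq L (q : site L) := on1 q pX.
Definition Yq L (q : site L) := on1 q pY.
Definition Zq L (q : site L) := on1 q pZ.

Definition flip L (y : basis L) (t : site L) : basis L :=
  [ffun k => if k == t then ~~ y k else y k].

(* CNOT with control c and target t *)
Definition cnot L (c t : site L) : op L :=
  opmx (fun x y => if x == (if y c then flip y t else y) then 1 else 0).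

(* controlled-Z on qubits a b *)
Definition cz L (a b : site L) : op L :=
  opmx (fun x y => if x == y then (if x a && x b then -1 else 1) else 0).

(* ---------- Jordan-Wigner encodings ---------- *)
(* Majorana chi_{2j} (odd = false) and chi_{2j+1} (odd = true) for mode j = qubit v *)
Definition majorana L (m : site L -> nat) (v : site L) (odd : bool) : op L :=
  (if odd then Yq v else Xq v) *m
  \big[mulmx/1%:M]_(k | (m k < m v)%N) Zq k.

(* W maps the JW encoding with ordering m to the one with ordering m' *)
Definition maps_encoding L (W : op L) (m m' : site L -> nat) : Prop :=
  forall (v : site L) (odd : bool),
    W *m majorana m v odd *m adj W = majorana m' v odd.

(* ---------- nearest-neighbour Clifford circuits ---------- *)
Inductive gate (L : nat) :=
  | G1 of site L & 'M[algC]_2      (* single-qubit gate *)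
  | GCNOT of site L & site L       (* control, target *)
  | GCZ of site L & site L.

Definition paulis1 : seq 'M[algC]_2 := [:: pX; - pX; pY; - pY; pZ; - pZ].

(* single-qubit Clifford unitary *)
Definition clifford1 (u : 'M[algC]_2) : bool :=
  [&& u *m adj u == 1%:M,
      u *m pX *m adj u \in paulis1 &
      u *m pZ *m adj u \in paulis1].

Definition gate_ok L (g : gate L) : bool :=
  match g with
  | G1 _ u => clifford1 u
  | GCNOT c t => adjacent c t
  | GCZ a b => adjacent a b
  end.

Definition gate_support L (g : gate L) : seq (site L) :=
  match g with
  | G1 q _ => [:: q]
  | GCNOT c t => [:: c; t]
  | GCZ a b => [:: a; b]
  end.

Definition gate_mx L (g : gate L) : op L :=
  match g with
  | G1 q u => on1 q u
  | GCNOT c t => cnot c t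
  | GCZ a b => cz a b
  end.

(* a layer: gates acting on pairwise disjoint sets of qubits *)
Definition layer L := seq (gate L).

Definition layer_ok L (l : layer L) : bool :=
  all (@gate_ok L) l && uniq (flatten (map (@gate_support L) l)).

Definition layer_mx L (l : layer L) : op L :=
  foldr (fun g A => gate_mx g *m A) 1%:M l.

(* a circuit is a sequence of layers; its depth is the number of layers *)
Definition circuit L := seq (layer L).

Definition circuit_ok L (C : circuit L) : bool := all (@layer_ok L) C.

(* first layer is applied first: W = L_k ... L_2 L_1 *)
Definition circuit_mx L (C : circuit L) : op L :=
  foldl (fun A l => layer_mx l *m A) 1%:M C.

Definition depth L (C : circuit L) : nat := size C.
Definition gate_count L (C : circuit L) : nat := sumn (map size C).

(* Main.v *)
Require Import Defs.
From mathcomp Require Import all_boot all_order all_algebra all_fingroup all_field.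
From mathcomp Require Import zify.
Set Implicit Arguments. Unset Strict Implicit. Unset Printing Implicit Defensive.
Import GRing.Theory.

(** A diagonal unitary (-1)^f changes the ordering m into m' as soon as flipping
  qubit v changes f by the parity of the qubits k whose order relative to v
  differs in m and m'; one such f is the sum of x_j x_k over the inverted pairs.
  Prefix sums along the axes are computed by CNOT ladders of depth O(L). After
  this change of variables the quadratic form f becomes a sum of local terms
  for the following elementary moves: reversing lines, planes or the whole cube
  along one axis (possibly depending on higher coordinates), and exchanging two
  adjacent axes of the hierarchy of which the higher one is traversed backwards.
  Every change of snake ordering is a composition of boundedly many such moves. *)

(** * Monomial matrices *)

Definition mono L (p : basis L -> basis L) (a : basis L -> algC) : 'M_(Defs.dim L) :=
  opmx (fun x y => if x == p y then a y else 0%R).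

Lemma eq_mono L (p q : basis L -> basis L) a b :
  p =1 q -> a =1 b -> mono p a = mono q b.
Proof. by move=> epq eab; apply/matrixP=> i j; rewrite !mxE epq eab. Qed.

Lemma mul_mono L (p q : basis L -> basis L) a b :
  (mono p a *m mono q b)%R = mono (p \o q) (fun y => a (q y) * b y)%R.
Proof.
apply/matrixP=> i j; rewrite !mxE (bigD1 (enum_rank (q (enum_val j)))) //=.
rewrite !mxE enum_rankK eqxx big1 ?addr0; first by case: ifP; rewrite ?mul0r.
move=> k ne; rewrite !mxE; case: (enum_val k =P q _) => [e|_]; last by rewrite mulr0.
by rewrite -e enum_valK eqxx in ne.
Qed.

Lemma mono_id1 L : mono (@id (basis L)) (fun=> 1%R) = 1%:M%R.
Proof.
apply/matrixP=> i j; rewrite !mxE (inj_eq enum_val_inj).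
by case: eqP.
Qed.

Definition sgn (b : bool) : algC := ((-1) ^+ b)%R.

Lemma sgnD a b : sgn (a (+) b) = (sgn a * sgn b)%R.
Proof. exact: signr_addb. Qed.

Lemma adj_diag L (f : basis L -> bool) :
  adj (mono id (fun y => sgn (f y))) = mono id (fun y => sgn (f y)).
Proof.
apply/matrixP=> i j; rewrite !mxE /= eq_sym; case: eqP => [->|_].
  by rewrite rmorphXn rmorphN rmorph1.
exact: rmorph0.
Qed.

Lemma b2o_eq x y : (b2o x == b2o y) = (x == y).
Proof. by rewrite -val_eqE /= !inordK; case: x; case: y. Qed.

Lemma val_b2o x : val (b2o x) = x :> nat.
Proof. by rewrite /= inordK //; case: x. Qed.

(** [on1] only compares basis states away from [q]. A bit has two values, so such an [x] is [y] or
    [flip y q], which exhibits the Pauli operators as monomial matrices. *)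
Lemma agree_off L (q : site L) (x y : basis L) :
  [forall k, (k != q) ==> (x k == y k)] =
  (x == if x q == y q then y else flip y q).
Proof.
apply/forallP/eqP => [h|h k].
  apply/ffunP=> k; have := h k; case: (altP (k =P q)) => [->|ne] /= e.
    by case: eqP => // /eqP ne; rewrite ffunE eqxx; case: (x q) (y q) ne => [] [].
  by rewrite (eqP e); case: ifP; rewrite ?ffunE ?(negbTE ne).
apply/implyP=> ne; rewrite {1}h.
by case: ifP; rewrite ?ffunE ?(negbTE ne).
Qed.

Lemma flipq L (q : site L) (y : basis L) : flip y q q = ~~ y q.
Proof. by rewrite ffunE eqxx. Qed.

Lemma XqE L (q : site L) : Xq q = mono (fun y => flip y q) (fun=> 1%R).
Proof.
apply/matrixP=> i j; rewrite !mxE agree_off b2o_eq.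
set x := enum_val i; set y := enum_val j.
case: (altP (x q =P y q)) => [e|ne] /=; last by case: ifP.
by case: ifP => _; case: eqP => // ex; move: e; rewrite ex flipq; case: (y q).
Qed.

Lemma YqE L (q : site L) :
  Yq q = mono (fun y => flip y q) (fun y => if y q then - 'i else 'i)%R.
Proof.
apply/matrixP=> i j; rewrite !mxE agree_off b2o_eq val_b2o.
set x := enum_val i; set y := enum_val j.
case: (altP (x q =P y q)) => [e|ne] /=.
  by case: ifP => _; case: eqP => // ex; move: e; rewrite ex flipq; case: (y q).
by case: ifP => // _; case: (x q) (y q) ne => [] [].
Qed.

Lemma ZqE L (q : site L) : Zq q = mono id (fun y => sgn (y q)).
Proof.
apply/matrixP=> i j; rewrite !mxE agree_off b2o_eq val_b2o.
set x := enum_val i; set y := enum_val j.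
case: (altP (x q =P y q)) => [e|ne] /=.
  by rewrite e; case: ifP => //; case: (y q).
have -> : (x == y) = false by apply/eqP => exy; rewrite exy eqxx in ne.
by case: ifP.
Qed.

Lemma prod_Zq L (p : pred (site L)) :
  \big[mulmx/1%:M%R]_(k | p k) Zq k =
  mono id (fun y => sgn (\big[addb/false]_(k | p k) y k)).
Proof.
elim: (index_enum _) => [|k s IH].
  by rewrite big_nil -mono_id1; apply: eq_mono => // y; rewrite big_nil.
rewrite big_cons IH; case: ifP => pk; last first.
  by apply: eq_mono => // y; rewrite big_cons pk.
by rewrite ZqE mul_mono; apply: eq_mono => // y; rewrite big_cons pk sgnD.
Qed.

Lemma majoranaE L (m : site L -> nat) v o :
  majorana m v o = mono (fun y => flip y v)
    (fun y => (if o then (if y v then - 'i else 'i) else 1)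
              * sgn (\big[addb/false]_(k | (m k < m v)%N) y k))%R.
Proof.
rewrite /majorana prod_Zq; case: o.
  by rewrite YqE mul_mono; apply: eq_mono.
by rewrite XqE mul_mono; apply: eq_mono.
Qed.

(** * Diagonal signs that change the ordering *)

Definition toggles L (m m' : site L -> nat) (f : basis L -> bool) : Prop :=
  forall v y, f (flip y v) (+) f y =
    \big[addb/false]_k (y k && ((m k < m v) (+) (m' k < m' v))).

Lemma big_addb_mkcond (I : finType) (p F : pred I) :
  \big[addb/false]_(k | p k) F k = \big[addb/false]_k (F k && p k).
Proof. by rewrite big_mkcond; apply: eq_bigr => k _; case: (p k); rewrite ?andbT ?andbF. Qed.

(** Both Majoranas at [v] flip the bit of [v], with an X or Y coefficient that does not depend on
    the ordering. Conjugation by the diagonal multiplies this coefficient by the signs of [f] before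
    and after the flip; by hypothesis their product is the ratio of the two Z-strings. *)
Lemma toggles_maps L (m m' : site L -> nat) f :
  toggles m m' f -> maps_encoding (mono id (fun y => sgn (f y))) m m'.
Proof.
move=> tg v o; rewrite !majoranaE adj_diag !mul_mono; apply: eq_mono => // y /=.
have := tg v y; rewrite (eq_bigr (fun k => (y k && (m k < m v)) (+) (y k && (m' k < m' v)))); last first.
  by move=> k _; rewrite -andb_addr.
rewrite big_split /= -!big_addb_mkcond.
set a := \big[_/_]_(_ | _) _; set b := \big[_/_]_(_ | _) _ => e.
have -> : b = f (flip y v) (+) a (+) f y.
  by move: e; case: (f _); case: (f _); case: a; case: b.
rewrite !sgnD mulrCA -!mulrA; congr (_ * _)%R; rewrite mulrCA; congr (_ * _)%R.
Qed.

(* Only meaningful on CNOT and CZ: single-qubit gates, never used, are ignored. *)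
Definition gate_run L (g : gate L) (s : basis L * bool) : basis L * bool :=
  match g with
  | G1 _ _ => s
  | GCNOT c t => (if s.1 c then flip s.1 t else s.1, s.2)
  | GCZ a b => (s.1, s.2 (+) (s.1 a && s.1 b))
  end.

Definition entangling L (g : gate L) : bool := if g is G1 _ _ then false else true.

Definition layer_run L (l : layer L) s := foldr (@gate_run L) s l.
Definition circuit_run L (C : circuit L) s := foldl (fun s l => layer_run l s) s C.

(** A circuit of CNOT and CZ gates is a classical map carrying one extra bit for the sign; its
    matrix is read off from runs started with sign bit [false]. *)
Definition smx L (r : basis L * bool -> basis L * bool) :=
  mono (fun y => (r (y, false)).1) (fun y => sgn (r (y, false)).2).

(** The sign bit is added to but never read. This makes composition of runs agree with
    multiplication of matrices. *)
Definition equivariant L (r : basis L * bool -> basis L * bool) :=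
  forall y b, r (y, b) = ((r (y, false)).1, b (+) (r (y, false)).2).

Lemma mul_smx L (r s : basis L * bool -> basis L * bool) : equivariant r ->
  (smx r *m smx s)%R = smx (r \o s).
Proof.
move=> er; rewrite mul_mono; apply: eq_mono => y /=.
  by case: (s _) => z b; rewrite (er z b).
by case: (s _) => z b; rewrite (er z b) sgnD mulrC.
Qed.

Lemma comp_equivariant L (r s : basis L * bool -> basis L * bool) :
  equivariant r -> equivariant s -> equivariant (r \o s).
Proof.
move=> er es y b; rewrite /= es er; case: (s _) => z c /=.
by rewrite (er z c) /= addbA.
Qed.

Lemma gate_run_equivariant L (g : gate L) : equivariant (gate_run g).
Proof. by case: g => [q u|c t|a b] y o //=; rewrite addbF. Qed.

Lemma gate_mxE L (g : gate L) : entangling g -> gate_mx g = smx (gate_run g).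
Proof.
case: g => [q u|c t|a b] //= _; apply/matrixP=> i j; rewrite !mxE /=.
by case: eqP => // ->; case: (_ && _).
Qed.

Lemma layer_mxE L (l : layer L) : all (@entangling L) l ->
  layer_mx l = smx (layer_run l) /\ equivariant (layer_run l).
Proof.
elim: l => [_|g l IH /= /andP[eg /IH[-> el]]].
  by split=> [|y b]; [exact: (esym (mono_id1 L)) | rewrite /= addbF].
have er := @gate_run_equivariant _ g.
rewrite gate_mxE // mul_smx //; split=> //.
exact: comp_equivariant er el.
Qed.

Lemma circuit_mxE L (C : circuit L) : all (all (@entangling L)) C ->
  circuit_mx C = smx (circuit_run C) /\ equivariant (circuit_run C).
Proof.
elim/last_ind: C => [_|C l IH]; first by split=> [|y b]; [exact: (esym (mono_id1 L)) | rewrite /= addbF].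
rewrite all_rcons => /andP[/layer_mxE[El el] /IH[EC eC]].
have E s : circuit_run (rcons C l) s = layer_run l (circuit_run C s).
  by rewrite /circuit_run foldl_rcons.
rewrite /circuit_mx foldl_rcons -/(circuit_mx C) EC El mul_smx //; split.
  by apply: eq_mono => y; rewrite E.
by move=> y b; rewrite !E; apply: (comp_equivariant el eC).
Qed.

(** * Level-by-level nearest-neighbour circuits *)

(** The predecessor is truncated: 0 is sent to 0. Hence [down i] moves to a neighbour only where the
    coordinate [i] is positive. *)
Definition lower L (x : 'I_L) : 'I_L :=
  Ordinal (leq_ltn_trans (leq_pred x) (ltn_ord x)).

Definition down L (i : 'I_3) (w : site L) : site L :=
  [ffun j => if j == i then lower (w j) else w j].

(** A step down lowers the level by one, so gates joining the sites of one level to their lower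
    neighbours along a fixed axis act on disjoint qubits. With at most 3L levels, one layer per
    level gives depth O(L). *)
Definition level L (w : site L) : nat := \sum_(i < 3) w i.

Lemma level_down L i (w : site L) : 0 < w i -> level w = (level (down i w)).+1.
Proof.
move=> wi; rewrite /level (bigD1 i) //= [in RHS](bigD1 i) //= ffunE eqxx /=.
rewrite -addSn prednK //; congr (_ + _); apply: eq_bigr => j /negbTE ne.
by rewrite ffunE ne.
Qed.

Lemma level_lt L (w : site L) : level w < 3 * L.
Proof.
rewrite /level !big_ord_recl big_ord0.
have := ltn_ord (w ord0); have := ltn_ord (w (lift ord0 ord0)).
have := ltn_ord (w (lift ord0 (lift ord0 ord0))); lia.
Qed.

Lemma down_inj L i (v w : site L) : 0 < v i -> 0 < w i -> down i v = down i w -> v = w.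
Proof.
move=> vi wi /ffunP e; apply/ffunP=> j; have := e j; rewrite !ffunE.
case: eqP => // -> /(congr1 val) /= e'; apply: val_inj => /=; lia.
Qed.

Lemma adjacentC L (v w : site L) : adjacent v w = adjacent w v.
Proof. by rewrite /adjacent /l1dist; congr (_ == _); apply: eq_bigr => i _; rewrite addnC. Qed.

Lemma adjacent_down L i (w : site L) : 0 < w i -> adjacent (down i w) w.
Proof.
move=> wi; rewrite /adjacent /l1dist (bigD1 i) //= ffunE eqxx /= big1; first by apply/eqP; lia.
by move=> j /negbTE ne; rewrite ffunE ne subnn.
Qed.

Lemma circuit_run_cat L (C D : circuit L) s :
  circuit_run (C ++ D) s = circuit_run D (circuit_run C s).
Proof. exact: foldl_cat. Qed.

(** A single constant bounds depth and size, so that concatenation simply adds constants. *)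
Definition valid L (n : nat) (C : circuit L) : bool :=
  [&& circuit_ok C, all (all (@entangling L)) C, depth C <= n * L &
      gate_count C <= n * L ^ 3].

Lemma valid_cat L n p (C D : circuit L) : valid n C -> valid p D -> valid (n + p) (C ++ D).
Proof.
move=> /and4P[oC eC dC gC] /and4P[oD eD dD gD]; apply/and4P; split.
- by rewrite /circuit_ok all_cat; apply/andP.
- by rewrite all_cat eC.
- by rewrite /depth size_cat mulnDl leq_add.
- by rewrite /gate_count map_cat sumn_cat mulnDl leq_add.
Qed.

Lemma valid_rev L n (C : circuit L) : valid n (rev C) = valid n C.
Proof. by rewrite /valid /circuit_ok !all_rev /depth size_rev /gate_count map_rev sumn_rev. Qed.

Lemma valid_leq L n p (C : circuit L) : n <= p -> valid n C -> valid p C.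
Proof.
move=> np /and4P[oC eC dC gC]; apply/and4P; split=> //.
  exact: leq_trans dC (leq_mul np (leqnn _)).
exact: leq_trans gC (leq_mul np (leqnn _)).
Qed.

Definition reversible L (C : circuit L) : Prop :=
  forall s, circuit_run (rev C) (circuit_run C s) = s.

Lemma reversible_cat L (C D : circuit L) : reversible C -> reversible D -> reversible (C ++ D).
Proof. by move=> rC rD s; rewrite rev_cat !circuit_run_cat rD rC. Qed.

(** * Layers of parallel CNOT and CZ gates *)

Definition cnots L (f g : site L -> site L) (s : seq (site L)) : layer L :=
  [seq GCNOT (f v) (g v) | v <- s].
Definition czs L (f g : site L -> site L) (s : seq (site L)) : layer L :=
  [seq GCZ (f v) (g v) | v <- s].

Lemma uniq_pairs (T U : eqType) (f g : T -> U) s : uniq s ->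
  {in s &, injective f} -> {in s &, injective g} ->
  {in s &, forall v w, f v != g w} ->
  uniq (flatten [seq [:: f v; g v] | v <- s]).
Proof.
move=> us fi gi fg.
have pe : perm_eq (flatten [seq [:: f v; g v] | v <- s]) (map f s ++ map g s).
  elim: s {us fi gi fg} => //= v s IH; rewrite perm_cons perm_sym.
  by rewrite -[g v :: map _ _]cat1s perm_catCA /= perm_cons perm_sym.
rewrite (perm_uniq pe) cat_uniq !map_inj_in_uniq // us andbT /=.
apply/hasPn=> _ /mapP[w ws ->]; apply/mapP=> -[v vs e].
by have := fg v w vs ws; rewrite e eqxx.
Qed.

Lemma cnots_ok L f g (s : seq (site L)) : uniq s ->
  {in s, forall v, adjacent (f v) (g v)} ->
  {in s &, injective f} -> {in s &, injective g} ->
  {in s &, forall v w, f v != g w} ->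
  layer_ok (cnots f g s) && layer_ok (czs f g s).
Proof.
move=> us ad fi gi fg; have := uniq_pairs us fi gi fg.
rewrite /layer_ok /cnots /czs -!map_comp !all_map => ->; rewrite !andbT.
by apply/andP; split; apply/allP=> v /ad.
Qed.

(** Since no control is also a target, the gates do not influence each other: every target receives
    the original values of its controls. *)
Lemma cnots_run L f g (s : seq (site L)) x b : {in s &, forall v w, f v != g w} ->
  layer_run (cnots f g s) (x, b) =
  ([ffun k => x k (+) \big[addb/false]_(v <- s | g v == k) x (f v)], b).
Proof.
elim: s => [_|v s IH fg] /=.
  by congr pair; apply/ffunP=> k; rewrite ffunE big_nil addbF.
rewrite IH /=; last by move=> u w us ws; apply: fg; rewrite inE ?us ?ws orbT.
have -> : [ffun k => x k (+) \big[addb/false]_(w <- s | g w == k) x (f w)] (f v) = x (f v).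
  rewrite ffunE big1_seq ?addbF // => w /andP[/eqP e ws].
  by have := fg v w (mem_head _ _); rewrite inE ws orbT e eqxx => /(_ isT).
congr pair; apply/ffunP=> k; rewrite [in RHS]ffunE big_cons.
set S := bigop _ _ _.
by case: ifP => xv; rewrite !ffunE -/S 1?eq_sym; case: ifP => // _;
  case: (x k); case: S.
Qed.

Lemma cnots_run_in L (f g : site L -> site L) (s : seq (site L)) (x : basis L) v : uniq s -> v \in s ->
  {in s &, injective g} ->
  \big[addb/false]_(w <- s | g w == g v) x (f w) = x (f v).
Proof.
move=> us vs gi; rewrite -big_filter (_ : [seq _ <- s | _] = [:: v]) ?big_seq1 //.
rewrite -(filter_pred1_uniq us vs); apply: eq_in_filter => w ws /=.
by apply/eqP/eqP => [|->//]; apply: gi.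
Qed.

Lemma cnots_run_notin L (f g : site L -> site L) (s : seq (site L)) (x : basis L) u :
  {in s, forall w, u != g w} -> \big[addb/false]_(w <- s | g w == u) x (f w) = false.
Proof.
move=> ug; rewrite big1_seq // => w /andP[/eqP e ws].
by have := ug w ws; rewrite e eqxx.
Qed.

Lemma cnots_runK L f g (s : seq (site L)) z : {in s &, forall v w, f v != g w} ->
  layer_run (cnots f g s) (layer_run (cnots f g s) z) = z.
Proof.
case: z => x b fg; rewrite !cnots_run //; congr pair; apply/ffunP=> k.
rewrite !ffunE -addbA -[RHS]addbF; congr addb.
set S := bigop _ _ _; set S' := bigop _ _ _; suff -> : S' = S by rewrite addbb.
rewrite /S /S' big_seq_cond [in RHS]big_seq_cond; apply: eq_bigr => v /andP[vs _].
rewrite ffunE cnots_run_notin ?addbF // => w ws; exact: fg.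
Qed.

Lemma czs_run L f g (s : seq (site L)) x b :
  layer_run (czs f g s) (x, b) = (x, b (+) \big[addb/false]_(v <- s) (x (f v) && x (g v))).
Proof.
elim: s => [|v s IH] /=; first by rewrite big_nil addbF.
by rewrite IH /= big_cons -addbA; congr (_, _ (+) _); rewrite addbC.
Qed.

(** * Sweeps through the levels of the lattice *)

Fixpoint sweep L (ls : nat -> circuit L) (n : nat) : circuit L :=
  if n is p.+1 then sweep ls p ++ ls p else [::].

Definition level_sites L (T : pred (site L)) t :=
  [seq v <- enum {: site L} | T v && (level v == t)].

Lemma mem_level_sites L (T : pred (site L)) t v :
  (v \in level_sites T t) = T v && (level v == t).
Proof. by rewrite mem_filter mem_enum andbT. Qed.

Lemma level_sites_uniq L (T : pred (site L)) t : uniq (level_sites T t).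
Proof. by rewrite filter_uniq ?enum_uniq. Qed.

(** The 3L levels contribute [k] layers each. As every site lies on exactly one level, a selected
    site is charged [k] gates in total, hence at most k L^3 gates. *)
Lemma sweep_valid L (T : pred (site L)) k (ls : nat -> circuit L) :
  (forall t, [/\ circuit_ok (ls t), all (all (@entangling L)) (ls t), size (ls t) = k &
    gate_count (ls t) = k * size (level_sites T t)]) ->
  valid (3 * k) (sweep ls (3 * L)).
Proof.
move=> H; have K n : [&& circuit_ok (sweep ls n), all (all (@entangling L)) (sweep ls n),
   depth (sweep ls n) == n * k &
   gate_count (sweep ls n) == k * count [pred v | T v && (level v < n)] (enum {: site L})].
  elim: n => [|n /and4P[o e /eqP d /eqP g]] /=.
    rewrite /gate_count /= (eq_count (a2 := pred0)) ?count_pred0 ?muln0 //.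
    by move=> v /=; rewrite ltn0 andbF.
  have [o' e' d' g'] := H n.
  apply/and4P; split.
  - by rewrite /circuit_ok all_cat; apply/andP.
  - by rewrite all_cat e.
  - by rewrite /depth size_cat -/(depth _) d d' mulSn addnC.
  rewrite /gate_count map_cat sumn_cat -/(gate_count _) g -/(gate_count _) g' -mulnDr.
  rewrite size_filter -count_predUI [X in _ + X](eq_count (a2 := pred0)); last first.
    by move=> v /=; case: (T v) => //=; lia.
  rewrite count_pred0 addn0; apply/eqP; congr (_ * _); apply: eq_count => v /=.
  by rewrite ltnS [in RHS]leq_eqVlt; case: (T v); rewrite //= orbC.
have /and4P[o e /eqP d /eqP g] := K (3 * L).
rewrite /valid o e d g /=; apply/andP; split; first lia.
have : count [pred v | T v & level v < 3 * L] (enum (site L)) <= L ^ 3.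
  by rewrite (leq_trans (count_size _ _)) // -cardE card_ffun !card_ord.
nia.
Qed.

(** * Prefix sums and phases *)

Definition box L (S : seq 'I_3) (u w : site L) : bool :=
  [forall l, if l \in S then u l <= w l else u l == w l].

Definition boxsum L (S : seq 'I_3) (x : basis L) : basis L :=
  [ffun w => \big[addb/false]_(u | box S u w) x u].

Lemma boxsum0 L (x : basis L) : boxsum [::] x = x.
Proof.
apply/ffunP=> w; rewrite ffunE (big_pred1 w) // => u.
apply/forallP/eqP => [h|-> //]; apply/ffunP=> l; exact/eqP/h.
Qed.

Lemma box_eq L (S : seq 'I_3) i (u w : site L) : i \notin S ->
  box S u w = box (i :: S) u w && (u i == w i).
Proof.
move=> /negbTE iS; apply/forallP/andP => [h|[/forallP h /eqP e] l].
  have := h i; rewrite iS => ei; split=> //; apply/forallP=> l; have := h l.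
  by rewrite inE; case: (l =P i) => [->|] //=; rewrite (eqP ei) leqnn.
by have := h l; rewrite inE; case: (l =P i) => //= -> _; rewrite iS e.
Qed.

Lemma box_zero L (S : seq 'I_3) i (u w : site L) : i \notin S -> w i = 0 :> nat ->
  box (i :: S) u w = box S u w.
Proof.
move=> iS wi; rewrite (box_eq _ _ iS) andb_idr // => /forallP/(_ i).
by rewrite mem_head wi leqn0 -val_eqE /= wi.
Qed.

Lemma box_down L (S : seq 'I_3) i (u w : site L) : i \in S -> 0 < w i ->
  box S u (down i w) = box S u w && (u i != w i).
Proof.
move=> iS wi; apply/forallP/andP => [h|[/forallP h ne] l].
  have := h i; rewrite iS ffunE eqxx /= => hi; split; last first.
    by rewrite -val_eqE /=; lia.
  apply/forallP=> l; have := h l; rewrite ffunE; case: (l =P i) => // -> _.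
  by rewrite iS; lia.
have := h l; rewrite ffunE; case: (l =P i) => // ->; rewrite iS /=.
by rewrite -val_eqE /= in ne; lia.
Qed.

Lemma boxsum_zero L (S : seq 'I_3) i (x : basis L) (w : site L) : i \notin S -> w i = 0 :> nat ->
  boxsum (i :: S) x w = boxsum S x w.
Proof. by move=> iS wi; rewrite !ffunE; apply: eq_bigl => u; apply: box_zero. Qed.

(** The recurrence of prefix sums: the box below [w] splits into its top slice along [i] and the box
    below [down i w]. *)
Lemma boxsum_pos L (S : seq 'I_3) i (x : basis L) (w : site L) : i \notin S -> 0 < w i ->
  boxsum (i :: S) x w = boxsum S x w (+) boxsum (i :: S) x (down i w).
Proof.
move=> iS wi; rewrite !ffunE (bigID (fun u : site L => u i == w i)) /=; congr addb.
  by apply: eq_bigl => u; rewrite -box_eq.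
by apply: eq_bigl => u; rewrite box_down ?mem_head.
Qed.

Definition ladder L (i : 'I_3) : circuit L :=
  sweep (fun t => [:: cnots (down i) id (level_sites (fun w : site L => 0 < w i) t)]) (3 * L).

Lemma down_neq L i t (v w : site L) :
  v \in level_sites (fun w : site L => 0 < w i) t -> w \in level_sites (fun w : site L => 0 < w i) t ->
  down i v != w.
Proof.
rewrite !mem_level_sites => /andP[vi /eqP lv] /andP[_ /eqP lw].
by apply/eqP => e; have := level_down vi; rewrite e lv lw; lia.
Qed.

Lemma ladder_valid L i : valid 3 (ladder L i).
Proof.
apply: (@sweep_valid _ (fun w : site L => 0 < w i) 1) => t.
have := @cnots_ok _ (down i) id (level_sites (fun w : site L => 0 < w i) t) (level_sites_uniq _ _).
case/(_ _ _ _ _)/andP => //.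
- by move=> v; rewrite mem_level_sites => /andP[vi _]; apply: adjacent_down.
- move=> v w; rewrite !mem_level_sites => /andP[vi _] /andP[wi _]; exact: down_inj.
- exact: down_neq.
move=> ok _; split=> //; first by rewrite /circuit_ok /= ok.
  by rewrite /= andbT /cnots all_map; apply/allP.
by rewrite /gate_count /= size_map addn0 mul1n.
Qed.

Lemma sweep_reversible L (ls : nat -> circuit L) n :
  (forall t, reversible (ls t)) -> reversible (sweep ls n).
Proof. by move=> H; elim: n => // n IH; apply: reversible_cat. Qed.

Lemma ladder_reversible L i : reversible (ladder L i).
Proof.
by apply: sweep_reversible => t s; rewrite /circuit_run /= cnots_runK // => v w; apply: down_neq.
Qed.

Lemma ladder_run L (S : seq 'I_3) i (x : basis L) b : i \notin S ->
  circuit_run (ladder L i) (boxsum S x, b) = (boxsum (i :: S) x, b).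
Proof.
move=> iS; rewrite /ladder.
(* Levels are treated in increasing order, so [down i w] already holds its new prefix sum when it is
   added to [w], which still holds the old one. *)
have H n : circuit_run (sweep (fun t => [:: cnots (down i) id
    (level_sites (fun w : site L => 0 < w i) t)]) n) (boxsum S x, b) =
  ([ffun w => if level w < n then boxsum (i :: S) x w else boxsum S x w], b).
  elim: n => [|n IH]; first by congr pair; apply/ffunP => w; rewrite [RHS]ffunE ltn0.
  rewrite circuit_run_cat IH /circuit_run /= cnots_run; last by move=> v w; apply: down_neq.
  congr pair; apply/ffunP=> w; rewrite [LHS]ffunE [RHS]ffunE [X in X (+) _]ffunE.
  have [lt|gt|e] := ltngtP (level w) n.
  - rewrite cnots_run_notin ?addbF ?ltnS 1?ltnW // => v; rewrite mem_level_sites => /andP[_ /eqP lv].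
    by apply: contraL lt => /eqP ->; rewrite lv ltnn.
  - rewrite cnots_run_notin ?addbF 1?ltnNge ?gt // => v; rewrite mem_level_sites => /andP[_ /eqP lv].
    by apply: contraL gt => /eqP ->; rewrite lv ltnn.
  rewrite e ltnSn; case: (posnP (w i)) => wi.
    rewrite cnots_run_notin ?addbF ?boxsum_zero // => v; rewrite mem_level_sites => /andP[vi _].
    by apply: contraL vi => /eqP <-; rewrite wi.
  have ws : w \in level_sites (fun w : site L => 0 < w i) n by rewrite mem_level_sites wi e eqxx.
  rewrite (@cnots_run_in _ (down i) id _ _ w) ?level_sites_uniq // [X in _ (+) X]ffunE.
  by have := level_down wi; rewrite e => ->; rewrite ltnSn [RHS]boxsum_pos.
rewrite H; congr pair; apply/ffunP=> w.
by rewrite [LHS]ffunE level_lt.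
Qed.

(* CNOT, CZ, CNOT: the phase (x_(d v) + x_(c v)) x_(k v), where c v and k v need
   only be neighbours of d v; also covers diagonal CZs and, for c = k, a Z. *)
Definition phase_gadget L (c d k : site L -> site L) (s : seq (site L)) : circuit L :=
  [:: cnots c d s; czs d k s; cnots c d s].

Lemma phase_gadget_run L (c d k : site L -> site L) s x b : uniq s ->
  {in s &, injective d} -> {in s &, forall v w, c v != d w} ->
  {in s &, forall v w, k v != d w} ->
  circuit_run (phase_gadget c d k s) (x, b) =
  (x, b (+) \big[addb/false]_(v <- s) ((x (d v) (+) x (c v)) && x (k v))).
Proof.
move=> us di cd kd; rewrite /circuit_run /phase_gadget /=.
have := cnots_runK (x, b) cd; rewrite cnots_run // => E.
rewrite czs_run.
set y := finfun _ in E *.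
have -> : \big[addb/false]_(v <- s) (y (d v) && y (k v)) =
          \big[addb/false]_(v <- s) ((x (d v) (+) x (c v)) && x (k v)).
  rewrite big_seq [RHS]big_seq; apply: eq_bigr => v vs.
  (* [d v] is the target of exactly one CNOT and [k v] of none, so only the first factor of the CZ
     phase is modified. *)
  rewrite !ffunE cnots_run_in // cnots_run_notin ?addbF // => w ws; exact: kd.
by move: E; rewrite !cnots_run // => -[->].
Qed.

Definition phase_sweep L (T : pred (site L)) c d k : circuit L :=
  sweep (fun t => phase_gadget c d k (level_sites T t)) (3 * L).

(** [sweep_neq] compares sites of equal level only, because different levels are handled in
    different layers. The choice c = k is allowed. *)
Record sweepable L (T : pred (site L)) (c d k : site L -> site L) : Prop := Sweepable {
  sweep_c : {in T &, injective c}; sweep_d : {in T &, injective d};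
  sweep_k : {in T &, injective k};
  sweep_cd : forall v, T v -> adjacent (c v) (d v);
  sweep_dk : forall v, T v -> adjacent (d v) (k v);
  sweep_neq : forall v w, T v -> T w -> level v = level w -> (c v != d w) && (k v != d w) }.

Lemma phase_sweep_valid L (T : pred (site L)) c d k : sweepable T c d k ->
  valid 9 (phase_sweep T c d k).
Proof.
case=> ci di ki cd dk neq; apply: (@sweep_valid _ T 3) => t; set s := level_sites T t.
have sT v : v \in s -> T v by rewrite mem_level_sites => /andP[].
have sl v w : v \in s -> w \in s -> level v = level w.
  by rewrite !mem_level_sites => /andP[_ /eqP->] /andP[_ /eqP->].
have us : uniq s := level_sites_uniq _ _.
have /andP[ok1 _] : layer_ok (cnots c d s) && layer_ok (czs c d s).
  apply: cnots_ok => //.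
  - by move=> v /sT; apply: cd.
  - by move=> v w /sT vT /sT; apply: ci.
  - by move=> v w /sT vT /sT; apply: di.
  by move=> v w vs ws; case/andP: (neq v w (sT _ vs) (sT _ ws) (sl _ _ vs ws)).
have /andP[_ ok2] : layer_ok (cnots d k s) && layer_ok (czs d k s).
  apply: cnots_ok => //.
  - by move=> v /sT; apply: dk.
  - by move=> v w /sT vT /sT; apply: di.
  - by move=> v w /sT vT /sT; apply: ki.
  move=> v w vs ws; rewrite eq_sym.
  by case/andP: (neq w v (sT _ ws) (sT _ vs) (sl _ _ ws vs)).
split=> //; first by rewrite /circuit_ok /= ok1 ok2.
  by rewrite /= /cnots /czs !all_map andbT; apply/and3P; split; apply/allP.
by rewrite /gate_count /= !size_map; lia.
Qed.

Lemma phase_sweep_run L (T : pred (site L)) c d k x b : sweepable T c d k ->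
  circuit_run (phase_sweep T c d k) (x, b) =
  (x, b (+) \big[addb/false]_(v | T v) ((x (d v) (+) x (c v)) && x (k v))).
Proof.
move=> sw; have H n : circuit_run (sweep (fun t => phase_gadget c d k (level_sites T t)) n) (x, b) =
  (x, b (+) \big[addb/false]_(v | T v && (level v < n)) ((x (d v) (+) x (c v)) && x (k v))).
  elim: n => [|n IH] /=.
    by rewrite big_pred0 ?addbF // => v; rewrite ltn0 andbF.
  rewrite circuit_run_cat IH phase_gadget_run ?level_sites_uniq //.
  - rewrite -addbA; congr (_, _ (+) _).
    rewrite [RHS](bigID (fun v => level v == n)) /= addbC; congr addb.
      rewrite big_filter big_enum_cond /=; apply: eq_bigl => v; rewrite -andbA; congr andb.
      by case: eqP => [->|]; rewrite ?ltnSn ?andbF.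
    by apply: eq_bigl => v; rewrite -andbA; congr andb; lia.
  - move=> v w; rewrite !mem_level_sites => /andP[vT _] /andP[wT _]; exact: (sweep_d sw).
  - move=> v w; rewrite !mem_level_sites => /andP[vT /eqP lv] /andP[wT /eqP lw].
    by have /andP[] := sweep_neq sw vT wT (etrans lv (esym lw)).
  move=> v w; rewrite !mem_level_sites => /andP[vT /eqP lv] /andP[wT /eqP lw].
  by have /andP[] := sweep_neq sw vT wT (etrans lv (esym lw)).
rewrite /phase_sweep H; congr (_, _ (+) _); apply: eq_bigl => v.
by rewrite level_lt andbT.
Qed.

(** * Quadratic phases and conversions *)

Lemma big_addb_pred1 (I : finType) (F : pred I) v :
  \big[addb/false]_k (F k && (k == v)) = F v.
Proof. by rewrite -big_addb_mkcond big_pred1_eq. Qed.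

(** The derivative of a quadratic form over the field with two elements is linear, with coefficients
    given by the symmetrization of [R]; this must be the indicator of the inverted pairs. *)
Lemma quadratic_toggles L (m m' : site L -> nat) (f : basis L -> bool)
    (R : site L -> site L -> bool) :
  (forall x, f x = \big[addb/false]_j \big[addb/false]_k (R k j && (x j && x k))) ->
  (forall k, R k k = false) ->
  (forall k u, R k u (+) R u k = (m k < m u) (+) (m' k < m' u)) ->
  toggles m m' f.
Proof.
move=> fE Rirr RE v y; rewrite !fE -big_split /=.
under eq_bigr => j _ do rewrite -big_split /=.
(* Flipping [v] adds 1 to the variable of index [v]. Expanding the product leaves two linear terms
   and a diagonal one, which [Rirr] kills. *)
transitivity (\big[addb/false]_j \big[addb/false]_k
   (((R k j && y j) && (k == v)) (+) (((R k j && y k) && (j == v))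
     (+) (R k j && (j == v) && (k == v))))).
  apply: eq_bigr => j _; apply: eq_bigr => k _; rewrite !ffunE.
  by case: (j == v); case: (k == v); case: (R k j); case: (y j); case: (y k).
under eq_bigr => j _ do rewrite !big_split /= !big_addb_pred1.
rewrite !big_split /= exchange_big /= big_addb_pred1 Rirr addbF.
under [X in _ (+) X]eq_bigr => k _ do rewrite big_addb_pred1.
rewrite -big_split /=; apply: eq_bigr => k _.
by rewrite -RE; case: (y k); rewrite ?andbF ?andbT // addbC.
Qed.

Lemma last_ord_subproof L (x : 'I_L) : L.-1 < L.
Proof. by case: x => m; case: L. Qed.

(** The argument [x] witnesses that [L] is positive, so that L-1 is an index. *)
Definition last_ord L (x : 'I_L) : 'I_L := Ordinal (last_ord_subproof x).

Definition to_face L (Q : seq 'I_3) (u : site L) : site L :=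
  [ffun l => if l \in Q then last_ord (u l) else u l].

Lemma box_face L (Q : seq 'I_3) (u v : site L) : v = to_face Q v ->
  box Q u v = (to_face Q u == v).
Proof.
move=> vE; apply/forallP/eqP => [h|<- l]; last first.
  by rewrite ffunE; case: (l \in Q) => //=; have := ltn_ord (u l); lia.
apply/ffunP=> l; have := h l; rewrite vE !ffunE; case: (l \in Q) => [_|/eqP //].
exact: val_inj.
Qed.

(* [to_face Q j] is the end of the line, plane, ... through j along the axes Q,
   where the ladders accumulate the total over that line, plane, ... *)
Definition cross_rel L (T : pred (site L)) (d : site L -> site L) (Q S : seq 'I_3)
    (k j : site L) : bool :=
  T (to_face Q j) && box S k (d (to_face Q j)).

(** For [v] on the far face, the box below [v] along [Q] is the whole fibre of [to_face Q] over [v].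
    Grouping the sites [j] by this fibre turns the sum of products into a double sum. *)
Lemma boxsum_quadratic L (T : pred (site L)) d (Q S : seq 'I_3) x :
  (forall v, T v -> v = to_face Q v) ->
  \big[addb/false]_(v | T v) (boxsum Q x v && boxsum S x (d v)) =
  \big[addb/false]_j \big[addb/false]_k (cross_rel T d Q S k j && (x j && x k)).
Proof.
move=> TQ; pose F j := x j && boxsum S x (d (to_face Q j)).
transitivity (\big[addb/false]_(j | T (to_face Q j)) F j).
  rewrite [RHS](partition_big (to_face Q) T) //=; apply: eq_bigr => v Tv.
  rewrite ffunE big_distrl /=; apply: eq_big => [j|j].
    by rewrite (box_face _ (TQ v Tv)) andbC; case: eqP => //= ->.
  by rewrite (box_face _ (TQ v Tv)) /F => /eqP ->.
rewrite big_mkcond; apply: eq_bigr => j _; rewrite /F /cross_rel.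
case: ifP => _; last by rewrite big1.
rewrite ffunE big_distrr big_mkcond; apply: eq_bigr => k _ /=.
by case: ifP.
Qed.

Fixpoint ladders L (S : seq 'I_3) : circuit L :=
  if S is i :: Q then ladders L Q ++ ladder L i else [::].

Lemma ladders_valid L (S : seq 'I_3) : valid (size S * 3) (ladders L S).
Proof.
by elim: S => //= i Q IH; rewrite mulSn addnC; apply: valid_cat => //; apply: ladder_valid.
Qed.

Lemma ladders_reversible L (S : seq 'I_3) : reversible (ladders L S).
Proof.
by elim: S => //= i Q IH; apply: reversible_cat => //; apply: ladder_reversible.
Qed.

Lemma ladders_run L (S : seq 'I_3) (x : basis L) b : uniq S ->
  circuit_run (ladders L S) (x, b) = (boxsum S x, b).
Proof.
elim: S => [_|i Q IH /= /andP[iQ uQ]]; first by rewrite boxsum0.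
by rewrite circuit_run_cat IH // ladder_run.
Qed.

(** * Conversions between orderings *)

Definition converts L (n : nat) (m m' : site L -> nat) : Prop :=
  exists (C : circuit L) (f : basis L -> bool),
    [/\ valid n C, forall x b, circuit_run C (x, b) = (x, b (+) f x) & toggles m m' f].

Lemma converts_refl L (m : site L -> nat) : converts 0 m m.
Proof.
exists [::], (fun=> false); split=> // [x b|v y]; first by rewrite addbF.
by rewrite big1 // => k _; rewrite addbb andbF.
Qed.

Lemma converts_leq L n p (m m' : site L -> nat) : n <= p -> converts n m m' -> converts p m m'.
Proof. by move=> np [C [f [vC rC tC]]]; exists C, f; split=> //; apply: valid_leq vC. Qed.

Lemma converts_trans L n p (m m1 m2 : site L -> nat) :
  converts n m m1 -> converts p m1 m2 -> converts (n + p) m m2.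
Proof.
move=> [C [f [vC rC tC]]] [D [g [vD rD tD]]].
exists (C ++ D), (fun x => f x (+) g x); split.
- exact: valid_cat.
- by move=> x b; rewrite circuit_run_cat rC rD addbA.
move=> v y; rewrite addbACA tC tD -big_split; apply: eq_bigr => k _ /=.
by case: (y k); case: (m1 k < m1 v); case: (m k < m v); case: (m2 k < m2 v).
Qed.

Lemma converts_eq L n (m m' m1 m1' : site L -> nat) : m =1 m1 -> m' =1 m1' ->
  converts n m m' -> converts n m1 m1'.
Proof.
move=> e e' [C [f [vC rC tC]]]; exists C, f; split=> // v y.
by rewrite tC; apply: eq_bigr => k _; rewrite !e !e'.
Qed.

Lemma converts_circuit L n (m m' : site L -> nat) : converts n m m' ->
  exists C : circuit L, [/\ circuit_ok C, depth C <= n * L, gate_count C <= n * L ^ 3 &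
    maps_encoding (circuit_mx C) m m'].
Proof.
move=> [C [f [/and4P[oC eC dC gC] rC tC]]]; exists C; split=> //.
have [-> _] := circuit_mxE eC.
rewrite (_ : smx _ = mono id (fun y => sgn (f y))); first exact: toggles_maps.
by apply: eq_mono => y; rewrite rC.
Qed.

(** Prefix sums are computed, [D] applies its phase in the new variables, and the ladders are
    undone. The constant is 9 + 18 + 9: at most three ladders of constant 3 on each side, and room
    for two phase sweeps of constant 9. *)
Lemma conjugation_converts L (S Q : seq 'I_3) (T : pred (site L)) d (D : circuit L)
    (g : basis L -> bool) (m m' : site L -> nat) :
  uniq S -> size S <= 3 -> valid 18 D ->
  (forall y b, circuit_run D (y, b) = (y, b (+) g y)) ->
  (forall x, g (boxsum S x) =
     \big[addb/false]_(v | T v) (boxsum Q x v && boxsum S x (d v))) ->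
  (forall v, T v -> v = to_face Q v) ->
  (forall k, cross_rel T d Q S k k = false) ->
  (forall k u, cross_rel T d Q S k u (+) cross_rel T d Q S u k =
     (m k < m u) (+) (m' k < m' u)) ->
  converts 36 m m'.
Proof.
move=> uS sS vD rD gE TQ irr RE; pose V := ladders L S.
have vV : valid 9 V by apply: valid_leq (ladders_valid L S); lia.
exists (V ++ D ++ rev V), (fun x => g (boxsum S x)); split.
- by apply: (@valid_cat _ 9 27) => //; apply: (@valid_cat _ 18 9); rewrite // valid_rev.
- move=> x b; rewrite !circuit_run_cat ladders_run // rD.
  by rewrite -(ladders_run x _ uS) (ladders_reversible (L := L)).
apply: quadratic_toggles irr RE => x.
by rewrite gE boxsum_quadratic.
Qed.

(** Summing over pairs increasing along [i] multiplies the total of a slice along [Q] by the total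
    of all lower slices. In prefix-sum variables the former is the difference of two neighbouring
    bits and the latter is the lower bit, so each term lives on one edge. *)
Lemma chain_converts L i (Q : seq 'I_3) (sel : pred (site L)) (m m' : site L -> nat) :
  uniq (i :: Q) -> size Q <= 2 -> (forall v, sel v -> v = to_face Q v) ->
  let R k j := sel (to_face Q j) && box (i :: Q) k (to_face Q j) && (k i < j i) in
  (forall k u, R k u (+) R u k = (m k < m u) (+) (m' k < m' u)) ->
  converts 36 m m'.
Proof.
move=> /= /andP[iQ uQ] sQ selQ RE.
(* Sites with coordinate 0 have no lower slice, so discarding them loses no pair. *)
pose T v := sel v && (0 < v i).
have sw : sweepable T (down i) id (down i).
  split=> //; rewrite /T.
  - by move=> v w /andP[_ vi] /andP[_ wi]; apply: down_inj.
  - by move=> v w /andP[_ vi] /andP[_ wi]; apply: down_inj.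
  - by move=> v /andP[_ vi]; apply: adjacent_down.
  - by move=> v /andP[_ vi]; rewrite adjacentC; apply: adjacent_down.
  move=> v w /andP[_ vi] /andP[_ wi] e; rewrite andbb; apply/eqP => e'.
  by have := level_down vi; rewrite e' e; lia.
have RT k u : cross_rel T (down i) Q (i :: Q) k u =
    sel (to_face Q u) && box (i :: Q) k (to_face Q u) && (k i < u i).
  rewrite /cross_rel /T; have tu : to_face Q u i = u i by rewrite ffunE (negbTE iQ).
  rewrite tu -!andbA; case: (sel _) => //=; case: (posnP (u i)) => ui /=.
    by rewrite ui ltn0 andbF.
  rewrite box_down ?mem_head ?tu //; case: (boolP (box _ _ _)) => //= /forallP/(_ i).
  by rewrite mem_head tu -val_eqE /=; lia.
apply: (@conjugation_converts _ (i :: Q) Q T (down i) (phase_sweep T (down i) id (down i))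
  (fun y => \big[addb/false]_(v | T v) ((y v (+) y (down i v)) && y (down i v)))) => //=.
- by rewrite iQ.
- by apply: (@valid_leq _ 9); rewrite ?phase_sweep_valid.
- by move=> y b; rewrite phase_sweep_run.
- move=> x; apply: eq_bigr => v /andP[_ vi].
  by rewrite [X in (X (+) _)]boxsum_pos // -addbA addbb addbF.
- by move=> v /andP[/selQ].
- by move=> k; rewrite RT ltnn andbF.
by move=> k u; rewrite !RT.
Qed.

Lemma downC L i i' (v : site L) : down i (down i' v) = down i' (down i v).
Proof. by apply/ffunP=> l; rewrite !ffunE; case: ifP; case: ifP. Qed.

(** The slice total at [v] is the mixed second difference of the prefix sums over the unit square
    with top corner [v]. It is multiplied by the prefix sum at the opposite corner [z v], which
    collects the sites strictly below in both directions. *)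
Lemma quadrant_converts L i i' (Q : seq 'I_3) (sel : pred (site L)) (m m' : site L -> nat) :
  uniq (i :: i' :: Q) -> size Q <= 1 -> (forall v, sel v -> v = to_face Q v) ->
  let R k j := sel (to_face Q j) && box (i :: i' :: Q) k (to_face Q j) &&
               (k i < j i) && (k i' < j i') in
  (forall k u, R k u (+) R u k = (m k < m u) (+) (m' k < m' u)) ->
  converts 36 m m'.
Proof.
move=> uS sQ selQ R RE; set S := [:: i, i' & Q].
have [ii' iQ i'Q uQ] : [/\ i != i', i \notin Q, i' \notin Q & uniq Q].
  by move: uS => /= /and3P[]; rewrite inE negb_or => /andP[].
have iS : i \in S := mem_head _ _.
have i'S : i' \in S by rewrite !inE eqxx orbT.
pose T v := [&& sel v, 0 < v i & 0 < v i'].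
pose z (v : site L) := down i' (down i v).
have dii v : down i v i' = v i' :> nat by rewrite ffunE eq_sym (negbTE ii').
have di'i v : down i' v i = v i :> nat by rewrite ffunE (negbTE ii').
have zinj : {in T &, injective z}.
  move=> v w /and3P[_ vi vi'] /and3P[_ wi wi'] e; apply: (down_inj vi wi).
  by apply: (@down_inj _ i'); rewrite ?dii.
have iinj : {in T &, injective (down i)}.
  by move=> v w /and3P[_ vi vi'] /and3P[_ wi wi']; apply: down_inj.
have i'inj : {in T &, injective (down i')}.
  by move=> v w /and3P[_ vi vi'] /and3P[_ wi wi']; apply: down_inj.
have lz v : T v -> [/\ level v = (level (z v)).+2, level v = (level (down i v)).+1 &
    level v = (level (down i' v)).+1].
  move=> /and3P[_ vi vi']; rewrite -(level_down vi) -(level_down vi'); split=> //.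
  by rewrite (level_down vi) (@level_down _ i' (down i v)) ?dii.
have sw1 : sweepable T id (down i) z.
  split=> //.
  - by move=> v /and3P[_ vi vi']; rewrite adjacentC; apply: adjacent_down.
  - by move=> v /and3P[_ vi vi']; rewrite adjacentC; apply: adjacent_down; rewrite dii.
  move=> v w /lz[lv1 lv2 lv3] /lz[lw1 lw2 lw3] e; apply/andP; split; apply/eqP => e'.
    by move: lv2; rewrite e' in e *; lia.
  by rewrite e' in lv1; lia.
have sw2 : sweepable T z (down i') z.
  split=> //.
  - by move=> v /and3P[_ vi vi']; rewrite /z -downC; apply: adjacent_down; rewrite di'i.
  - by move=> v /and3P[_ vi vi']; rewrite adjacentC /z -downC; apply: adjacent_down; rewrite di'i.
  move=> v w /lz[lv1 lv2 lv3] /lz[lw1 lw2 lw3] e; rewrite andbb; apply/eqP => e'.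
  by rewrite e' in lv1; lia.
have RT k u : cross_rel T z Q S k u = R k u.
  rewrite /cross_rel /T /R -/S.
  have tu : to_face Q u i = u i by rewrite ffunE (negbTE iQ).
  have tu' : to_face Q u i' = u i' by rewrite ffunE (negbTE i'Q).
  rewrite tu tu' -!andbA; case: (sel _) => //=.
  case: (posnP (u i)) => ui /=; first by rewrite ui ltn0 andbF.
  case: (posnP (u i')) => ui' /=; first by rewrite ui' ltn0 !andbF.
  rewrite /z !box_down ?dii ?tu ?tu' //.
  have -> : (k i' != down i (to_face Q u) i') = (k i' != u i').
    by rewrite -!val_eqE /= dii tu'.
  rewrite -andbA; case: (boolP (box _ _ _)) => //= /forallP bx.
  have := bx i; have := bx i'; rewrite iS i'S tu tu' -!val_eqE /=; lia.
(* The four corners are split into two pairs of neighbours, one for each gadget; both middle corners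
   are adjacent to [z v]. *)
apply: (@conjugation_converts _ S Q T z (phase_sweep T id (down i) z ++ phase_sweep T z (down i') z)
  (fun y => \big[addb/false]_(v | T v) ((y (down i v) (+) y v) && y (z v)) (+)
            \big[addb/false]_(v | T v) ((y (down i' v) (+) y (z v)) && y (z v)))) => //.
- by apply: (@valid_cat _ 9 9); apply: phase_sweep_valid.
- by move=> y b; rewrite circuit_run_cat !phase_sweep_run // addbA.
- move=> x; rewrite -big_split /=; apply: eq_bigr => v /and3P[_ vi vi'].
  have iS' : i \notin i' :: Q by rewrite inE negb_or ii'.
  have := boxsum_pos x iS' vi; have : 0 < down i' v i by rewrite di'i.
  move=> /(boxsum_pos x iS'); have := boxsum_pos x i'Q vi'.
  rewrite -/S downC -/(z v) => -> -> ->; rewrite -andb_addl; congr andb.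
  by case: (boxsum S x (down i v)); case: (boxsum Q x v); case: (boxsum S x (z v));
     case: (boxsum (i' :: Q) x (down i' v)).
- by move=> v /and3P[/selQ].
- by move=> k; rewrite RT /R ltnn andbF.
by move=> k u; rewrite !RT.
Qed.

(** * Orderings *)

(* Lexicographic order with c the most significant axis; the parity of sa, sb, sc
   tells whether an axis is traversed backwards, given the higher coordinates. *)
Definition gsnake L (a b c : 'I_3) (sa : nat -> nat -> nat) (sb : nat -> nat) (sc : nat)
    (v : site L) : nat :=
  rho L (sa (v b) (v c)) (v a) + L * (rho L (sb (v c)) (v b) + L * rho L sc (v c)).

Lemma snakeE L (sg : 'S_3) (v : site L) :
  snake sg v = gsnake (sg ord0) (sg (inord 1)) (sg (inord 2)) addn id 0 v.
Proof.
have e1 : lift ord0 ord0 = inord 1 :> 'I_3 by apply: val_inj; rewrite /= inordK.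
have e2 : lift ord0 (lift ord0 ord0) = inord 2 :> 'I_3 by apply: val_inj; rewrite /= inordK.
rewrite /snake !big_ord_recl big_ord0 !(big_mkcond (fun k : 'I_3 => _ < k)) /=.
rewrite !big_ord_recl !big_ord0 /= e1 e2 /gsnake !addn0 !add0n mulnDr mulnA.
by rewrite expn0 mul1n expn1 mulnn.
Qed.

Lemma digit_lt L x X y Y : x < L -> y < L ->
  (x + L * X < y + L * Y) = if X == Y then x < y else X < Y.
Proof. by move=> xL yL; case: (ltngtP X Y) => [XY|XY|->]; nia. Qed.

Lemma rho_lt L s x : x < L -> rho L s x < L.
Proof. by rewrite /rho; case: ifP; lia. Qed.

Lemma rho_eq L s x y : x < L -> y < L -> (rho L s x == rho L s y) = (x == y).
Proof. by rewrite /rho; case: ifP; lia. Qed.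

Lemma rho_mono L s x y : x < L -> y < L -> x != y ->
  (rho L s x < rho L s y) = odd s (+) (x < y).
Proof. by rewrite /rho; case: (odd s) => /=; lia. Qed.

(** Directions are evaluated at [u] alone because each branch is reached only when the higher
    coordinates of [k] and [u] agree. *)
Lemma gsnake_lt L a b c sa sb sc (k u : site L) :
  (gsnake a b c sa sb sc k < gsnake a b c sa sb sc u) =
  if k c != u c :> nat then odd sc (+) (k c < u c) else
  if k b != u b :> nat then odd (sb (u c)) (+) (k b < u b) else
  if k a != u a :> nat then odd (sa (u b) (u c)) (+) (k a < u a) else false.
Proof.
have [ka kb kc] := And3 (ltn_ord (k a)) (ltn_ord (k b)) (ltn_ord (k c)).
have [ua ub uc] := And3 (ltn_ord (u a)) (ltn_ord (u b)) (ltn_ord (u c)).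
have E s (x x' y y' : nat) : x < L -> y < L ->
    (rho L s x + L * x' == rho L s y + L * y') = (x == y) && (x' == y').
  move=> xL yL; have := rho_eq s xL yL; have := rho_lt s xL; have := rho_lt s yL.
  move=> h1 h2 <-; apply/eqP/andP => [e|[/eqP-> /eqP->] //].
  have e' : x' = y' by nia.
  by rewrite e' eqxx; split=> //; apply/eqP; lia.
rewrite /gsnake digit_lt ?rho_lt //.
case: (eqVneq (k c : nat) (u c)) => [->|nc] /=; last first.
  rewrite (_ : _ == _ = false).
    by rewrite digit_lt ?rho_lt // rho_eq // (negbTE nc) rho_mono.
  apply/eqP => e; move: nc; rewrite -(rho_eq sc kc uc) => /negP[]; apply/eqP.
  have := rho_lt (sb (k c)) kb; have := rho_lt (sb (u c)) ub; nia.
rewrite E // eqxx andbT; case: (eqVneq (k b : nat) (u b)) => [->|nb] /=; last first.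
  by rewrite digit_lt ?rho_lt // eqxx rho_mono.
case: (eqVneq (k a : nat) (u a)) => [->|na] /=; first by rewrite ltnn.
by rewrite rho_mono.
Qed.

Lemma mem_axes (a b c l : 'I_3) : uniq [:: a; b; c] -> [|| l == a, l == b | l == c].
Proof.
move=> uabc; apply/negPn/negP => nl.
have : uniq [:: l; a; b; c] by rewrite cons_uniq uabc andbT !inE.
by move/card_uniqP => /= e; have := max_card [pred x in [:: l; a; b; c]]; rewrite e card_ord.
Qed.

Lemma forall_axes (a b c : 'I_3) (p : pred 'I_3) : uniq [:: a; b; c] ->
  [forall l, p l] = [&& p a, p b & p c].
Proof.
move=> uabc; apply/forallP/and3P => [h|[pa pb pc] l]; first by split; apply: h.
by case/or3P: (mem_axes l uabc) => /eqP ->.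
Qed.

Lemma to_face_axis L (Q : seq 'I_3) (u : site L) l :
  to_face Q u l = (if l \in Q then L.-1 else u l) :> nat.
Proof. by rewrite ffunE; case: (l \in Q). Qed.

Lemma leq_pred_ord L (x : 'I_L) : x <= L.-1.
Proof. by have := ltn_ord x; lia. Qed.

Lemma box_axes L (S : seq 'I_3) (a b c : 'I_3) (u w : site L) : uniq [:: a; b; c] ->
  box S u w = [&& if a \in S then u a <= w a else u a == w a :> nat,
    if b \in S then u b <= w b else u b == w b :> nat &
    if c \in S then u c <= w c else u c == w c :> nat].
Proof. by move=> uabc; rewrite /box (forall_axes _ uabc). Qed.

Lemma on_faceP L (Q : seq 'I_3) (v : site L) :
  all (fun l => v l == L.-1 :> nat) Q -> v = to_face Q v.
Proof.
move=> /allP h; apply/ffunP=> l; apply: val_inj; rewrite /= to_face_axis.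
by case: (boolP (l \in Q)) => // /h /eqP.
Qed.

Ltac order_cases k u a b c :=
  let split_axis l := case: (ltngtP (k l) (u l));
    [move=> _ | move=> _ | first [move=> -> | move=> _]] in
  split_axis c; split_axis b; split_axis a;
  rewrite ?ltnn /= ?andbF ?andbT ?addbb ?addbF //.

Lemma axes_neq (a b c : 'I_3) : uniq [:: a; b; c] ->
  [/\ (a == b) = false, (a == c) = false & (b == c) = false].
Proof.
by rewrite /= !inE negb_or andbT => /andP[/andP[/negbTE-> /negbTE->] /negbTE->].
Qed.

(** The inverted pairs are all pairs on a common line along [a] whose direction changes. *)
Lemma reverse_lines L (a b c : 'I_3) sa sa' sb sc : uniq [:: a; b; c] ->
  converts 36 (@gsnake L a b c sa sb sc) (gsnake a b c sa' sb sc).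
Proof.
move=> uabc; have [ab ac bc] := axes_neq uabc.
apply: (@chain_converts _ a [::]
  (fun v => odd (sa (v b) (v c)) (+) odd (sa' (v b) (v c)))) => //=.
  by move=> v _; apply: on_faceP.
move=> k u; rewrite !gsnake_lt !(box_axes _ _ _ uabc) !to_face_axis !inE.
rewrite eqxx ![_ == a]eq_sym ab ac.
by order_cases k u a b c; case: (odd _); case: (odd _).
Qed.

(** A pair is inverted irrespective of its coordinates along [a], so whole lines are summed at their
    ends; this is why [Q] contains [a]. *)
Lemma reverse_planes L (a b c : 'I_3) sa sb sb' sc : uniq [:: a; b; c] ->
  converts 36 (@gsnake L a b c sa sb sc) (gsnake a b c sa sb' sc).
Proof.
move=> uabc; have [ab ac bc] := axes_neq uabc.
apply: (@chain_converts _ b [:: a]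
  (fun v => (v a == L.-1 :> nat) && (odd (sb (v c)) (+) odd (sb' (v c))))) => //=.
- by rewrite inE eq_sym ab.
- by move=> v /andP[va _]; apply: on_faceP; rewrite /= va.
move=> k u; rewrite !gsnake_lt !(box_axes _ _ _ uabc) !to_face_axis !inE.
rewrite !eqxx ![b == _]eq_sym ![c == _]eq_sym ab ac bc !leq_pred_ord /=.
by order_cases k u a b c; case: (odd _); case: (odd _).
Qed.

Lemma reverse_all L (a b c : 'I_3) sa sb sc sc' : uniq [:: a; b; c] ->
  converts 36 (@gsnake L a b c sa sb sc) (gsnake a b c sa sb sc').
Proof.
move=> uabc; have [ab ac bc] := axes_neq uabc.
apply: (@chain_converts _ c [:: b; a]
  (fun v => [&& v a == L.-1 :> nat, v b == L.-1 :> nat & odd sc (+) odd sc'])) => //=.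
- by rewrite !inE ![c == _]eq_sym ac bc eq_sym ab.
- by move=> v /and3P[va vb _]; apply: on_faceP; rewrite /= va vb.
move=> k u; rewrite !gsnake_lt !(box_axes _ _ _ uabc) !to_face_axis !inE.
rewrite !eqxx ![b == _]eq_sym ![c == _]eq_sym ?ab ?ac ?bc !leq_pred_ord /= ?eqxx.
by order_cases k u a b c; case: (odd _); case: (odd _).
Qed.

Lemma change_directions L (a b c : 'I_3) sa sb sc sa' sb' sc' : uniq [:: a; b; c] ->
  converts 108 (@gsnake L a b c sa sb sc) (gsnake a b c sa' sb' sc').
Proof.
move=> uabc; apply: (@converts_trans _ 36 72); first exact: (@reverse_lines _ _ _ _ sa sa').
apply: (@converts_trans _ 36 36); first exact: (@reverse_planes _ _ _ _ _ sb sb').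
exact: reverse_all.
Qed.

(* With the higher of two adjacent axes reversed, the pairs whose order is
   exchanged are those increasing along both axes. *)
Lemma swap_low L (a b c : 'I_3) : uniq [:: a; b; c] ->
  converts 36 (@gsnake L a b c (fun _ _ => 0) (fun=> 1) 0)
              (gsnake b a c (fun _ _ => 1) (fun=> 0) 0).
Proof.
move=> uabc; have [ab ac bc] := axes_neq uabc.
apply: (@quadrant_converts _ a b [::] predT) => //=.
- by rewrite !inE ab.
- by move=> v _; apply: on_faceP.
move=> k u; rewrite !gsnake_lt !(box_axes _ _ _ uabc) !to_face_axis !inE.
rewrite !eqxx ![b == _]eq_sym ![c == _]eq_sym ?ab ?ac ?bc /= ?eqxx.
by order_cases k u a b c.
Qed.

(** Lines along [a] keep their direction and move as blocks, hence the totals over them. *)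
Lemma swap_high L (a b c : 'I_3) : uniq [:: a; b; c] ->
  converts 36 (@gsnake L a b c (fun _ _ => 0) (fun=> 0) 1)
              (gsnake a c b (fun _ _ => 0) (fun=> 1) 0).
Proof.
move=> uabc; have [ab ac bc] := axes_neq uabc.
apply: (@quadrant_converts _ b c [:: a] (fun v => v a == L.-1 :> nat)) => //=.
- by rewrite !inE bc ![_ == a]eq_sym ab ac.
- by move=> v va; apply: on_faceP; rewrite /= va.
move=> k u; rewrite !gsnake_lt !(box_axes _ _ _ uabc) !to_face_axis !inE.
rewrite !eqxx ![b == _]eq_sym ![c == _]eq_sym ?ab ?ac ?bc !leq_pred_ord /= ?eqxx.
by order_cases k u a b c.
Qed.

(** * Composition of the elementary moves *)

Lemma uniq_swap_low (a b c : 'I_3) : uniq [:: a; b; c] -> uniq [:: b; a; c].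
Proof. by move=> /axes_neq[ab ac bc]; rewrite /= !inE eq_sym ab ac bc. Qed.

Lemma uniq_swap_high (a b c : 'I_3) : uniq [:: a; b; c] -> uniq [:: a; c; b].
Proof. by move=> /axes_neq[ab ac bc]; rewrite /= !inE [c == b]eq_sym ab ac bc. Qed.

Lemma snake_swap_low L (a b c : 'I_3) : uniq [:: a; b; c] ->
  converts 252 (@gsnake L a b c addn id 0) (gsnake b a c addn id 0).
Proof.
move=> uabc.
(* The snake is put into the directions required by the swap, swapped, and restored: 252 = 108 + 36
   + 108. *)
apply: (@converts_trans _ 108 144 _ (gsnake a b c (fun _ _ => 0) (fun=> 1) 0)).
  exact: change_directions.
apply: (@converts_trans _ 36 108 _ (gsnake b a c (fun _ _ => 1) (fun=> 0) 0)).
  exact: swap_low.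
exact/change_directions/uniq_swap_low.
Qed.

Lemma snake_swap_high L (a b c : 'I_3) : uniq [:: a; b; c] ->
  converts 252 (@gsnake L a b c addn id 0) (gsnake a c b addn id 0).
Proof.
move=> uabc.
apply: (@converts_trans _ 108 144 _ (gsnake a b c (fun _ _ => 0) (fun=> 0) 1)).
  exact: change_directions.
apply: (@converts_trans _ 36 108 _ (gsnake a c b (fun _ _ => 0) (fun=> 1) 0)).
  exact: swap_high.
exact/change_directions/uniq_swap_high.
Qed.

(** Three adjacent transpositions suffice to reach any arrangement of three axes, whence 756 = 3 *
    252. *)
Lemma snake_converts L (a b c a' b' c' : 'I_3) : uniq [:: a; b; c] -> uniq [:: a'; b'; c'] ->
  converts 756 (@gsnake L a b c addn id 0) (gsnake a' b' c' addn id 0).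
Proof.
move=> u u'; have [n1 n2 n3] := axes_neq u'.
have lo := uniq_swap_low; have hi := uniq_swap_high.
have swlo := @snake_swap_low L; have swhi := @snake_swap_high L.
move: n1 n2 n3.
case/or3P: (mem_axes a' u) => /eqP ->; case/or3P: (mem_axes b' u) => /eqP ->;
case/or3P: (mem_axes c' u) => /eqP ->; rewrite ?eqxx // => _ _ _.
- exact: converts_leq (converts_refl _).
- by apply: converts_leq (swhi _ _ _ u).
- by apply: converts_leq (swlo _ _ _ u).
- by apply: converts_leq (converts_trans (swlo _ _ _ u) (swhi _ _ _ (lo _ _ _ u))).
- by apply: converts_leq (converts_trans (swhi _ _ _ u) (swlo _ _ _ (hi _ _ _ u))).
(* The remaining case is the full reversal, the only one that takes three transpositions. *)
apply: (@converts_trans _ 252 504) (swlo _ _ _ u) _.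
apply: (@converts_trans _ 252 252) (swhi _ _ _ (lo _ _ _ u)) _.
exact: swlo (hi _ _ _ (lo _ _ _ u)).
Qed.

Theorem mainTheorem12 :
  exists c : nat, forall (L : nat) (sg sg' : 'S_3),
    exists C : circuit L,
      [/\ circuit_ok C,
          (depth C <= c * L.+1)%N,
          (gate_count C <= c * (L ^ 3).+1)%N &
          maps_encoding (circuit_mx C) (snake sg) (snake sg')].
Proof.
exists 756 => L sg sg'.
have usg (s : 'S_3) : uniq [:: s ord0; s (inord 1); s (inord 2)].
  by rewrite /= !inE !(inj_eq perm_inj) -!val_eqE /= !inordK.
have := snake_converts L (usg sg) (usg sg').
move=> /(converts_eq (fsym (snakeE sg)) (fsym (snakeE sg')))/converts_circuit.
case=> C [oC dC gC mC]; exists C; split=> //.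
  by apply: leq_trans dC _; rewrite leq_mul.
by apply: leq_trans gC _; rewrite leq_mul.
Qed.
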